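(* Let $\Sigma$, $\rho$, $E(x,y)$, $\mathbb Q$, $\mathbb{IQ}$ and $\mathcal I$ be as in the context. Then: (i) for each $J\in\mathbb{IQ}$ and each $f\in\Sigma$, the set $C(J)=\{x\in J\mid\nabla x=x=\Delta x\}$ is closed under $f^J$; (ii) the assignment $\mathcal C\colon\mathbb{IQ}\to\mathbb Q$ sending $J$ to the $\Sigma$-algebra $\mathcal C(J)$ with universe $C(J)$ and operations $f^J$ restricted to $C(J)$, and sending a homomorphism $g\colon J\to K$ to its restriction to $C(J)$, is a well-defined faithful functor (in particular $\mathcal C(J)\in\mathbb Q$); (iii) for each $A\in\mathbb Q$ the map $\iota_A\colon A\to\mathcal C(\mathcal I(A))$, $\iota_A(a)=[a,a]$, is an isomorphism, and $A\mapsto\iota_A$ is a natural isomorphism from the identity functor of $\mathbb Q$ to $\mathcal C\circ\mathcal I$; (iv) for each $J\in\mathbb{IQ}$ the map $\gamma_J\colon J\to\mathcal I(\mathcal C(J))$, $\gamma_J(a)=[\Delta a,\nabla a]$, is a one-to-one homomorphism, and $J\mapsto\gamma_J$ is a natural transformation from the identity functor of $\mathbb{IQ}$ to $\mathcal I\circ\mathcal C$.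
   Context: $\Sigma$ is a set of constant and function symbols containing constants $0,1$. A polarity $\rho$ assigns to each $n$-ary function symbol $f\in\Sigma$ a tuple $\rho(f)\in\{+,-\}^n$. A $\rho$-poalgebra is a pair $(A,\leq)$ with $A$ a $\Sigma$-algebra and $\leq$ a partial order on $A$ such that each $f^A$ is monotone in its $k$-th argument if $\rho(f)_k=+$ and antitone if $\rho(f)_k=-$; it is bounded if $0^A\leq a\leq 1^A$ for all $a$. For a bounded $\rho$-poalgebra $A$, $\mathcal I(A)$ is the $(\Sigma\cup\{\Delta,\nabla,\iota\})$-algebra on $I(A)=\{[a,b]\mid a\leq b\}$ with $f^{\mathcal I(A)}([a_1,b_1],\dots,[a_n,b_n])=[f^A(c_1,\dots,c_n),f^A(d_1,\dots,d_n)]$, where $c_k=a_k,d_k=b_k$ if $\rho(f)_k=+$ and $c_k=b_k,d_k=a_k$ if $\rho(f)_k=-$, $\Delta[a,b]=[a,a]$, $\nabla[a,b]=[b,b]$, $\iota=[0^A,1^A]$. A set $E(x,y)$ of $\Sigma$-equations determines the order of $A$ if $a\leq b$ iff $t^A(a,b)=s^A(a,b)$ for all $t=s$ in $E(x,y)$. Standing assumptions: $\mathbb Q$ is a $\Sigma$-quasivariety of bounded $\rho$-poalgebras whose order is determined by a fixed set $E(x,y)$ of $\Sigma$-equations; $\mathbb{IQ}$ is the quasivariety generated by $\{\mathcal I(A)\mid A\in\mathbb Q\}$; both are categories with homomorphisms. $\mathcal I\colon\mathbb Q\to\mathbb{IQ}$ is the functor $A\mapsto\mathcal I(A)$, $h\mapsto\mathcal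 I(h)$ with $\mathcal I(h)([a,b])=[h(a),h(b)]$. *)

(* Defs.v *)
From mathcomp Require Import all_boot.
From mathcomp Require Import boolp.

Set Implicit Arguments.
Unset Strict Implicit.
Unset Printing Implicit Defensive.

Record signature := Signature {
  csym : Type;
  fsym : Type;
  ar : fsym -> nat }.

Record algebra (S : signature) := Algebra {
  carrier :> Type;
  cst : csym S -> carrier;
  op : forall f : fsym S, ('I_(ar f) -> carrier) -> carrier }.

Arguments cst {S} A c : rename.
Arguments op {S} A f a : rename.

Record is_hom (S : signature) (A B : algebra S) (h : A -> B) : Prop := IsHom {
  hom_cst : forall c, h (cst A c) = cst B c;
  hom_op : forall f (a : 'I_(ar f) -> A),
    h (op A f a) = op B f (fun k => h (a k)) }.

Record hom (S : signature) (A B : algebra S) := Hom {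
  hfun :> A -> B;
  homP : is_hom hfun }.

Inductive term (S : signature) (V : Type) : Type :=
  | Var of V
  | Cst of csym S
  | App (f : fsym S) of ('I_(ar f) -> term S V).

Fixpoint eval (S : signature) (V : Type) (A : algebra S) (v : V -> A)
    (t : term S V) : A :=
  match t with
  | Var x => v x
  | Cst c => cst A c
  | App f ts => op A f (fun k => eval v (ts k))
  end.

Definition equation (S : signature) (V : Type) : Type :=
  (term S V * term S V)%type.

Definition holds (S : signature) (V : Type) (A : algebra S) (v : V -> A)
    (e : equation S V) : Prop :=
  eval v e.1 = eval v e.2.

Record quasiequation (S : signature) := Quasiequation {
  npremises : nat;
  premise : 'I_npremises -> equation S nat;
  conclusion : equation S nat }.

Definition satisfies (S : signature) (A : algebra S) (q : quasiequation S) :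
    Prop :=
  forall v : nat -> A,
    (forall i, holds v (premise (q := q) i)) -> holds v (conclusion q).

Definition quasivariety (S : signature) (K : algebra S -> Prop) : Prop :=
  exists T : quasiequation S -> Prop,
    forall A, K A <-> (forall q, T q -> satisfies A q).

Definition generated_quasivariety (S : signature) (K : algebra S -> Prop)
    (A : algebra S) : Prop :=
  forall V : algebra S -> Prop,
    quasivariety V -> (forall B, K B -> V B) -> V A.

Record obj (S : signature) (K : algebra S -> Prop) := Obj {
  oalg :> algebra S;
  objP : K oalg }.

Lemma is_hom_id (S : signature) (A : algebra S) : @is_hom S A A (fun x => x).
Proof. by []. Qed.

Lemma is_hom_comp (S : signature) (A B C : algebra S) (g : hom B C)
  (h : hom A B) : is_hom (fun x => g (h x)).
Proof.
split=> [c|f a]; first by rewrite (hom_cst (homP h)) (hom_cst (homP g)).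
by rewrite (hom_op (homP h)) (hom_op (homP g)).
Qed.

Definition hid (S : signature) (A : algebra S) : hom A A := Hom (is_hom_id A).

Definition hcomp (S : signature) (A B C : algebra S) (g : hom B C)
  (h : hom A B) : hom A C := Hom (is_hom_comp g h).

Lemma homE (S : signature) (A B : algebra S) (g h : hom A B) :
  (forall x, g x = h x) -> g = h.
Proof.
case: g h => [g gP] [h hP] /= gh.
have {}gh : g = h by apply: funext.
by subst h; congr Hom; apply: Prop_irrelevance.
Qed.

Definition isomorphism (S : signature) (A B : algebra S) (h : hom A B) : Prop :=
  exists k : hom B A, hcomp k h = hid A /\ hcomp h k = hid B.

Record functor_data (S T : signature)
    (K : algebra S -> Prop) (L : algebra T -> Prop) := FunctorData {
  fobj :> obj K -> obj L;
  fmap : forall A B : obj K, hom A B -> hom (fobj A) (fobj B) }.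

Record is_functor (S T : signature)
    (K : algebra S -> Prop) (L : algebra T -> Prop)
    (F : functor_data K L) : Prop := IsFunctor {
  fmap_id : forall A : obj K, fmap F (hid A) = hid (F A);
  fmap_comp : forall (A B C : obj K) (g : hom B C) (h : hom A B),
    fmap F (hcomp g h) = hcomp (fmap F g) (fmap F h) }.

Definition faithful (S T : signature)
    (K : algebra S -> Prop) (L : algebra T -> Prop)
    (F : functor_data K L) : Prop :=
  forall (A B : obj K) (g h : hom A B), fmap F g = fmap F h -> g = h.

Definition id_functor (S : signature) (K : algebra S -> Prop) :
    functor_data K K :=
  @FunctorData S S K K (fun A => A) (fun A B h => h).

Definition comp_functor (S T U : signature) (K : algebra S -> Prop)
    (L : algebra T -> Prop) (M : algebra U -> Prop)
    (G : functor_data L M) (F : functor_data K L) : functor_data K M :=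
  @FunctorData S U K M (fun A => G (F A)) (fun A B h => fmap G (fmap F h)).

Definition natural (S T : signature)
    (K : algebra S -> Prop) (L : algebra T -> Prop)
    (F G : functor_data K L) (tau : forall A : obj K, hom (F A) (G A)) : Prop :=
  forall (A B : obj K) (h : hom A B),
    hcomp (tau B) (fmap F h) = hcomp (fmap G h) (tau A).

Record bsignature := BSignature {
  bsig :> signature;
  czero : csym bsig;
  cone : csym bsig;
  czero_neq_cone : czero <> cone }.

(* true stands for +, false for -. *)
Definition polarity (S : signature) := forall f : fsym S, 'I_(ar f) -> bool.

Record bounded_poalgebra (S : bsignature) (rho : polarity S) (A : algebra S)
    (le : A -> A -> Prop) : Prop := BoundedPoalgebra {
  po_refl : forall a, le a a;
  po_anti : forall a b, le a b -> le b a -> a = b;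
  po_trans : forall a b c, le a b -> le b c -> le a c;
  po_mono : forall f (k : 'I_(ar f)) (a b : 'I_(ar f) -> A),
    (forall j, j != k -> a j = b j) -> le (a k) (b k) ->
    if rho f k then le (op A f a) (op A f b) else le (op A f b) (op A f a);
  po_ge0 : forall a, le (cst A (czero S)) a;
  po_le1 : forall a, le a (cst A (cone S)) }.

Inductive xy := vx | vy.

Definition valxy (A : Type) (a b : A) (w : xy) : A :=
  match w with vx => a | vy => b end.

Definition eq_le (S : signature) (E : equation S xy -> Prop) (A : algebra S)
    (a b : A) : Prop :=
  forall e, E e -> holds (valxy a b) e.

Arguments eq_le {S} E A a b.

Definition determines_order (S : signature) (E : equation S xy -> Prop)
    (A : algebra S) (le : A -> A -> Prop) : Prop :=
  forall a b, le a b <-> eq_le E A a b.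

Definition poalgebras_ordered_by (S : bsignature) (rho : polarity S)
    (E : equation S xy -> Prop) (Q : algebra S -> Prop) : Prop :=
  forall A, Q A ->
    exists le : A -> A -> Prop,
      bounded_poalgebra rho le /\ determines_order E le.

Inductive ecsym (S : signature) := ECst of csym S | EIota.
Inductive efsym (S : signature) := EFun of fsym S | EDelta | ENabla.

Arguments EIota {S}.
Arguments EDelta {S}.
Arguments ENabla {S}.

Definition ext_sig (S : signature) : signature :=
  @Signature (ecsym S) (efsym S)
    (fun f => match f with EFun f => ar f | EDelta | ENabla => 1 end).

Definition ocst (S : signature) (J : algebra (ext_sig S)) (c : csym S) : J :=
  @cst (ext_sig S) J (ECst c).
Definition oop (S : signature) (J : algebra (ext_sig S)) (f : fsym S)
    (a : 'I_(ar f) -> J) : J :=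
  @op (ext_sig S) J (EFun f) a.
Definition Delta (S : signature) (J : algebra (ext_sig S)) (x : J) : J :=
  @op (ext_sig S) J EDelta (fun=> x).
Definition Nabla (S : signature) (J : algebra (ext_sig S)) (x : J) : J :=
  @op (ext_sig S) J ENabla (fun=> x).

Arguments ocst {S} J c.
Arguments oop {S} J f a.

Record interval (A : Type) (le : A -> A -> Prop) := Interval {
  lo : A;
  hi : A;
  lo_le_hi : le lo hi }.

Lemma intervalE (A : Type) (le : A -> A -> Prop) (x y : interval le) :
  lo x = lo y -> hi x = hi y -> x = y.
Proof.
case: x y => [a b ab] [c d cd] /= ac bd; subst c d.
by congr Interval; apply: Prop_irrelevance.
Qed.

Section IntervalAlgebra.
Variables (S : bsignature) (rho : polarity S) (A : algebra S).
Variables (le : A -> A -> Prop) (poA : bounded_poalgebra rho le).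

Definition lo_args (f : fsym S) (x : 'I_(ar f) -> interval le) (k : 'I_(ar f)) :=
  if rho k then lo (x k) else hi (x k).
Definition hi_args (f : fsym S) (x : 'I_(ar f) -> interval le) (k : 'I_(ar f)) :=
  if rho k then hi (x k) else lo (x k).

Lemma op_lo_le_hi (f : fsym S) (x : 'I_(ar f) -> interval le) :
  le (op A f (lo_args x)) (op A f (hi_args x)).
Proof.
pose mix m (j : 'I_(ar f)) := if j < m then hi_args x j else lo_args x j.
have mix0 : mix 0 = lo_args x by apply: funext.
have mixn : mix (ar f) = hi_args x.
  by apply: funext => j; rewrite /mix ltn_ord.
rewrite -mix0 -mixn; have := leqnn (ar f).
elim: {-2}(ar f) => [|m IH] mf; first exact: (po_refl poA).
apply: (po_trans poA (IH (ltnW mf))).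
pose k := Ordinal mf.
have neq j : j != k -> mix m j = mix m.+1 j.
  move=> jk; rewrite /mix ltnS (leq_eqVlt j m).
  by have /negPf -> : nat_of_ord j != m by apply: contra jk => /eqP jm; apply/eqP/val_inj.
have mk : mix m k = lo_args x k by rewrite /mix /= ltnn.
have mk1 : mix m.+1 k = hi_args x k by rewrite /mix /= leqnn.
have := @po_mono _ _ _ _ poA f k (mix m) (mix m.+1) neq.
have := @po_mono _ _ _ _ poA f k (mix m.+1) (mix m)
  (fun j jk => esym (neq j jk)).
rewrite mk mk1 /lo_args /hi_args; case: (rho k) => H1 H2.
  by apply: H2; apply: lo_le_hi.
by apply: H1; apply: lo_le_hi.
Qed.

Definition diag (a : A) : interval le := Interval (po_refl poA a).

Definition interval_cst (c : ecsym S) : interval le :=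
  match c with
  | ECst c => diag (cst A c)
  | EIota => Interval (po_ge0 poA (cst A (cone S)))
  end.

Definition interval_op (f : efsym S) :
    ('I_(@ar (ext_sig S) f) -> interval le) -> interval le :=
  match f with
  | EFun f => fun x => Interval (op_lo_le_hi x)
  | EDelta => fun x => diag (lo (x ord0))
  | ENabla => fun x => diag (hi (x ord0))
  end.

Definition interval_algebra : algebra (ext_sig S) :=
  @Algebra (ext_sig S) (interval le) interval_cst interval_op.

End IntervalAlgebra.

Section IntervalFunctor.
Variables (S : bsignature) (rho : polarity S).
Variables (E : equation S xy -> Prop) (Q : algebra S -> Prop).
Hypothesis ordQ : poalgebras_ordered_by rho E Q.

Lemma eq_le_poalgebra (A : obj Q) : bounded_poalgebra rho (eq_le E A).
Proof.
have [le [leP leE]] := ordQ (objP A).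
suff <- : le = eq_le E A by [].
by apply: funext => a; apply: funext => b; apply: propext.
Qed.

(* The order witnessed by ordQ is necessarily eq_le E A. *)
Definition Ialg (A : obj Q) : algebra (ext_sig S) :=
  interval_algebra (eq_le_poalgebra A).

Definition IQ : algebra (ext_sig S) -> Prop :=
  generated_quasivariety (fun B => exists A : obj Q, B = Ialg A).

Lemma Ialg_IQ (A : obj Q) : IQ (Ialg A).
Proof. by move=> V _; apply; exists A. Qed.

Lemma hom_eval (A B : algebra S) (h : hom A B) V (v : V -> A) (t : term S V) :
  h (eval v t) = eval (fun x => h (v x)) t.
Proof.
elim: t => [x|c|f ts IH] //=; first exact: (hom_cst (homP h)).
by rewrite (hom_op (homP h)); congr (op B f _); apply: funext => k; apply: IH.
Qed.

Lemma hom_eq_le (A B : algebra S) (h : hom A B) (a b : A) :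
  eq_le E A a b -> eq_le E B (h a) (h b).
Proof.
move=> ab e Ee.
have hv : valxy (h a) (h b) = (fun w => h (valxy a b w)).
  by apply: funext; case.
by rewrite /holds hv -!hom_eval (ab e Ee).
Qed.

Definition Ifun (A B : obj Q) (h : hom A B) (x : Ialg A) : Ialg B :=
  Interval (hom_eq_le h (lo_le_hi x)).

Lemma Ifun_hom (A B : obj Q) (h : hom A B) : is_hom (Ifun h).
Proof.
split=> [[c|]|[f||] a]; apply: intervalE => //=; rewrite ?(hom_cst (homP h)) //.
- rewrite (hom_op (homP h)); congr (op B f _); apply: funext => k.
  by rewrite /lo_args; case: (rho k).
- rewrite (hom_op (homP h)); congr (op B f _); apply: funext => k.
  by rewrite /hi_args; case: (rho k).
Qed.

Definition Ifunctor : functor_data Q IQ :=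
  @FunctorData S (ext_sig S) Q IQ (fun A => Obj (Ialg_IQ A))
    (fun A B h => Hom (Ifun_hom h)).

Lemma Ifunctor_is_functor : is_functor Ifunctor.
Proof. by split=> *; apply: homE => x; apply: intervalE. Qed.

End IntervalFunctor.

Section Centre.
Variable S : signature.

Definition Cset (J : algebra (ext_sig S)) (x : J) : Prop :=
  Nabla x = x /\ x = Delta x.

Definition sigma_closed (J : algebra (ext_sig S)) (X : J -> Prop) : Prop :=
  (forall c, X (ocst J c)) /\
  (forall f (a : 'I_(ar f) -> J), (forall k, X (a k)) -> X (oop J f a)).

Definition Calg (J : algebra (ext_sig S)) (clJ : sigma_closed (@Cset J)) :
    algebra S :=
  @Algebra S {x : J | Cset x}
    (fun c => exist _ (ocst J c) (clJ.1 c))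
    (fun f a => exist _ (oop J f (fun k => sval (a k)))
                        (clJ.2 f _ (fun k => svalP (a k)))).

Definition Cfun (J K : algebra (ext_sig S)) (g : J -> K)
    (gC : forall x, Cset x -> Cset (g x)) (x : {x : J | Cset x}) :
    {x : K | Cset x} :=
  exist _ (g (sval x)) (gC _ (svalP x)).

(* The arguments are exactly the well-definedness conditions on C: closure of
   C(J) under the operations, membership of C(J) in Q, and the restrictions
   being homomorphisms between the algebras C(J). *)
Definition Cfunctor (Q : algebra S -> Prop) (R : algebra (ext_sig S) -> Prop)
    (Ccl : forall J : obj R, sigma_closed (@Cset J))
    (CQ : forall J : obj R, Q (Calg (Ccl J)))
    (CC : forall (J K : obj R) (g : hom J K) (x : J), Cset x -> Cset (g x))
    (Chom : forall (J K : obj R) (g : hom J K),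
       @is_hom S (Calg (Ccl J)) (Calg (Ccl K)) (Cfun (@CC J K g))) :
    functor_data R Q :=
  @FunctorData (ext_sig S) S R Q (fun J => Obj (CQ J))
    (fun J K g => Hom (Chom J K g)).

End Centre.

(* Main.v *)
Require Import Defs.
From mathcomp Require Import all_boot.
From mathcomp Require Import boolp.

Set Implicit Arguments.
Unset Strict Implicit.
Unset Printing Implicit Defensive.

(** In an interval algebra I(A), the elements Delta x and Nabla x are diagonal,
    the diagonal is a copy of A, and x is determined by Delta x and Nabla x.
    All of this is expressed by quasi-equations, which pass to every J in IQ;
    the last of them makes gamma injective and C faithful.  A quasi-equation
    over Sigma holds in C(J) exactly when the one obtained by replacing each
    variable x by Delta x holds in J.  Since C(I(A)) is isomorphic to A, this
    carries the axioms of Q over to C(J).  The order is equational too, so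
    Delta a <= Nabla a in C(J) because lo a <= hi a in every I(A). *)

Arguments Var {S V} x : rename.
Arguments Cst {S V} c : rename.

Section Substitution.
Variable S : signature.

Fixpoint subst (V W : Type) (sigma : V -> term S W) (t : term S V) :
    term S W :=
  match t with
  | Var x => sigma x
  | Cst c => Cst c
  | App f ts => @App S W f (fun k => subst sigma (ts k))
  end.

Definition subst_equation (V W : Type) (sigma : V -> term S W)
    (e : equation S V) : equation S W :=
  (subst sigma e.1, subst sigma e.2).

Lemma eval_subst (V W : Type) (A : algebra S) (sigma : V -> term S W)
    (u : W -> A) (t : term S V) :
  eval u (subst sigma t) = eval (fun x => eval u (sigma x)) t.
Proof.
by elim: t => [x|c|f ts IH] //=; congr (op A f _); apply: funext => k.
Qed.

Lemma holds_subst (V W : Type) (A : algebra S) (sigma : V -> term S W)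
    (u : W -> A) (e : equation S V) :
  holds u (subst_equation sigma e) = holds (fun x => eval u (sigma x)) e.
Proof. by rewrite /holds !eval_subst. Qed.

End Substitution.

Section QuasiEquations.
Variable S : signature.

Definition valid_implication (A : algebra S) (V I : Type)
    (prem : I -> equation S V) (concl : equation S V) : Prop :=
  forall v : V -> A, (forall i, holds v (prem i)) -> holds v concl.

Lemma quasivariety_satisfies (q : quasiequation S) :
  quasivariety (fun A => satisfies A q).
Proof. by exists (eq q) => A; split=> [Aq _ <-|]; last apply. Qed.

Lemma generated_quasivariety_implication (K : algebra S -> Prop)
    (A : algebra S) (V : countType) (I : finType)
    (prem : I -> equation S V) (concl : equation S V) :
  generated_quasivariety K A ->
  (forall B, K B -> valid_implication B prem concl) ->
  valid_implication A prem concl.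
Proof.
move=> KA validK v vprem.
pose rename := subst_equation (fun x : V => @Var S nat (pickle x)).
pose q := Quasiequation (fun i : 'I_#|I| => rename (prem (enum_val i)))
  (rename concl).
have Aq : satisfies A q.
  apply: (KA _ (quasivariety_satisfies q)) => B KB u uprem.
  rewrite holds_subst; apply: validK => // i.
  by have := uprem (enum_rank i); rewrite /= holds_subst enum_rankK.
(* V may be empty, so the default value, for the variables that do not occur,
   is the value of a term. *)
pose u n := if unpickle n is Some x then v x else eval v concl.1.
have uE : (fun x : V => eval u (Var (pickle x))) = v.
  by apply: funext => x; rewrite /= /u pickleK.
by have := Aq u; rewrite /= holds_subst uE; apply=> i; rewrite holds_subst uE.
Qed.

Lemma generated_quasivariety_identity (K : algebra S -> Prop)
    (A : algebra S) (V : countType) (e : equation S V) :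
  generated_quasivariety K A ->
  (forall B, K B -> forall u : V -> B, holds u e) ->
  forall v : V -> A, holds v e.
Proof.
move=> KA Ke v.
apply: (generated_quasivariety_implication (prem := of_void _) KA _ (v := v)).
  by move=> B KB u _; apply: Ke.
by case.
Qed.

End QuasiEquations.

Lemma is_hom_can (S : signature) (A B : algebra S) (h : A -> B) (k : B -> A) :
  is_hom h -> cancel h k -> cancel k h -> is_hom k.
Proof.
move=> hP hK kK; split=> [c|f b]; apply: (can_inj hK); rewrite kK.
  by rewrite (hom_cst hP).
by rewrite (hom_op hP); congr (op B f _); apply: funext => i; rewrite kK.
Qed.

Section InjectiveHomomorphisms.
Variables (S : bsignature) (A B : algebra S).
Variables (h : hom A B) (h_inj : injective h).

Lemma holds_injective (V : Type) (v : V -> A) (e : equation S V) :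
  holds (fun x => h (v x)) e <-> holds v e.
Proof. by rewrite /holds -!(hom_eval h v); split=> [/h_inj|->]. Qed.

Lemma satisfies_injective (q : quasiequation S) :
  satisfies B q -> satisfies A q.
Proof.
move=> Bq v vprem; apply/holds_injective/Bq => i.
exact/holds_injective/vprem.
Qed.

Lemma eq_le_injective (E : equation S xy -> Prop) (a b : A) :
  eq_le E B (h a) (h b) -> eq_le E A a b.
Proof.
move=> hab e Ee; apply/holds_injective.
have -> : (fun w => h (valxy a b w)) = valxy (h a) (h b).
  by apply: funext; case.
exact: hab.
Qed.

End InjectiveHomomorphisms.

Section ExtendedSignature.
Variable S : signature.
Implicit Types J K : algebra (ext_sig S).

Definition reduct J : algebra S := Algebra (ocst J) (oop J).

Fixpoint lift_term (V : Type) (t : term S V) : term (ext_sig S) V :=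
  match t with
  | Var x => Var x
  | Cst c => @Cst (ext_sig S) V (ECst c)
  | App f ts => @App (ext_sig S) V (EFun f) (fun k => lift_term (ts k))
  end.

Definition lift_equation (V : Type) (e : equation S V) :
    equation (ext_sig S) V :=
  (lift_term e.1, lift_term e.2).

Lemma eval_lift J (V : Type) (v : V -> J) (t : term S V) :
  eval v (lift_term t) = eval (A := reduct J) v t.
Proof.
by elim: t => [x|c|f ts IH] //=; congr (oop J f _); apply: funext => k.
Qed.

Lemma holds_lift J (V : Type) (v : V -> J) (e : equation S V) :
  holds v (lift_equation e) = holds (A := reduct J) v e.
Proof. by rewrite /holds !eval_lift. Qed.

Definition ociota J : J := @cst (ext_sig S) J EIota.

(* Encoding the lower endpoint by true matches the encoding of polarities:
   endpoint_oop below then reads b == rho k. *)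
Definition endpoint J (lower : bool) (x : J) : J :=
  if lower then Delta x else Nabla x.

Definition endpoint_term (V : Type) (lower : bool) (t : term (ext_sig S) V) :
    term (ext_sig S) V :=
  if lower then @App (ext_sig S) V EDelta (fun=> t)
  else @App (ext_sig S) V ENabla (fun=> t).

Lemma eval_endpoint J (V : Type) (v : V -> J) (b : bool)
    (t : term (ext_sig S) V) :
  eval v (endpoint_term b t) = endpoint b (eval v t).
Proof. by case: b. Qed.

Lemma hom_endpoint J K (g : hom J K) (b : bool) (x : J) :
  g (endpoint b x) = endpoint b (g x).
Proof. by case: b; apply: (hom_op (homP g)). Qed.

Lemma Cset_endpointP J (x : J) : Cset x <-> forall b, endpoint b x = x.
Proof.
split=> [[Nx Dx] []|x_fix]; [exact: esym | exact: Nx |].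
by split; [apply: (x_fix false) | rewrite (x_fix true : Delta x = x)].
Qed.

End ExtendedSignature.

Lemma sval_inj (T : Type) (P : T -> Prop) : injective (@sval T P).
Proof. by move=> [x Px] [y Py]; apply: eq_exist. Qed.

Section Centre.
Variable S : bsignature.

Definition Delta_equation (e : equation S nat) : equation (ext_sig S) nat :=
  subst_equation (fun n => endpoint_term true (Var n)) (lift_equation e).

Definition Delta_quasiequation (q : quasiequation S) :
    quasiequation (ext_sig S) :=
  Quasiequation (fun i => Delta_equation (premise (q := q) i))
    (Delta_equation (conclusion q)).

Variable J : algebra (ext_sig S).
Hypothesis clJ : sigma_closed (@Cset S J).

Lemma sval_is_hom : @is_hom S (Calg clJ) (reduct J) sval.
Proof. by []. Qed.

Definition centre_inclusion : hom (Calg clJ) (reduct J) := Hom sval_is_hom.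

Lemma holds_Delta_equation (u : nat -> J) (v : nat -> Calg clJ)
    (e : equation S nat) :
  (forall n, Delta (u n) = sval (v n)) ->
  holds u (Delta_equation e) <-> holds v e.
Proof.
move=> uv; rewrite holds_subst holds_lift.
have -> : (fun n => eval u (endpoint_term true (Var n))) =
          (fun n => centre_inclusion (v n)) by apply: funext.
by apply: holds_injective; apply: sval_inj.
Qed.

Lemma satisfies_Delta_quasiequation (q : quasiequation S) :
  (forall x : J, Cset (Delta x)) ->
  satisfies J (Delta_quasiequation q) <-> satisfies (Calg clJ) q.
Proof.
move=> CDelta; split=> Jq v vprem.
  have vv n : Delta (sval (v n)) = sval (v n) by case: (svalP (v n)) => _ <-.
  apply/(holds_Delta_equation _ vv)/Jq => i.
  exact/(holds_Delta_equation _ vv)/vprem.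
pose w n : Calg clJ := exist _ _ (CDelta (v n)).
have vw n : Delta (v n) = sval (w n) by [].
apply/(holds_Delta_equation _ vw)/Jq => i.
exact/(holds_Delta_equation _ vw)/vprem.
Qed.

End Centre.

Section CentreMorphisms.
Variables (S : signature) (J K : algebra (ext_sig S)) (g : hom J K).

Lemma hom_Cset (x : J) : Cset x -> Cset (g x).
Proof.
move/Cset_endpointP => xC; apply/Cset_endpointP => b.
by rewrite -hom_endpoint xC.
Qed.

Lemma Cfun_is_hom (clJ : sigma_closed (@Cset S J))
    (clK : sigma_closed (@Cset S K)) :
  @is_hom S (Calg clJ) (Calg clK) (Cfun hom_Cset).
Proof.
by split=> [c|f a]; apply: sval_inj;
  [apply: (hom_cst (homP g)) | apply: (hom_op (homP g))].
Qed.

End CentreMorphisms.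

Section IntervalAlgebra.
Variables (S : bsignature) (rho : polarity S) (A : algebra S).
Variables (le : A -> A -> Prop) (poA : bounded_poalgebra rho le).

Local Notation IA := (interval_algebra poA).

Lemma diag_is_hom : @is_hom S A (reduct IA) (diag poA).
Proof.
split=> [//|f a]; apply: intervalE => /=; congr (op A f _);
  by apply: funext => k; rewrite /lo_args /hi_args; case: (rho k).
Qed.

Definition diag_hom : hom A (reduct IA) := Hom diag_is_hom.

Definition interval_bound (b : bool) (x : IA) : A := if b then lo x else hi x.

Lemma interval_endpoint (b : bool) (x : IA) :
  endpoint b x = diag poA (interval_bound b x).
Proof. by case: b. Qed.

Lemma interval_endpoint_inj (x y : IA) :
  (forall b, endpoint b x = endpoint b y) -> x = y.
Proof.
move=> xy; apply: intervalE.
- exact: (congr1 (@lo _ _) (xy true)).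
- exact: (congr1 (@lo _ _) (xy false)).
Qed.

Lemma interval_endpoint_oop (b : bool) f (x : 'I_(ar f) -> IA) :
  endpoint b (oop IA f x) = oop IA f (fun k => endpoint (b == rho k) (x k)).
Proof.
have -> : (fun k => endpoint (b == rho k) (x k)) =
          (fun k => diag poA (interval_bound (b == rho k) (x k))).
  by apply: funext => k; rewrite interval_endpoint.
rewrite -[RHS](hom_op diag_is_hom) interval_endpoint; congr diag.
by case: b; congr (op A f _); apply: funext => k;
  rewrite /lo_args /hi_args; case: (rho k).
Qed.

Lemma Cset_intervalP (x : IA) : Cset x <-> diag poA (lo x) = x.
Proof.
split=> [[_ xD]|<-]; first exact: esym.
by split; apply: intervalE.
Qed.

Lemma Cset_diag (a : A) : @Cset S IA (diag poA a).
Proof. exact/Cset_intervalP. Qed.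

Variable clI : sigma_closed (@Cset S IA).

Definition centre_diag (a : A) : Calg clI := exist _ _ (Cset_diag a).

Definition centre_lo (x : Calg clI) : A := lo (sval x).

Lemma centre_diagK : cancel centre_diag centre_lo.
Proof. by []. Qed.

Lemma centre_loK : cancel centre_lo centre_diag.
Proof. by move=> [x xC]; apply: sval_inj; apply/Cset_intervalP. Qed.

Lemma centre_diag_is_hom : is_hom centre_diag.
Proof.
by split=> [c|f a]; apply: sval_inj;
  [apply: (hom_cst diag_is_hom) | apply: (hom_op diag_is_hom)].
Qed.

Definition centre_diag_hom : hom A (Calg clI) := Hom centre_diag_is_hom.

Definition centre_lo_hom : hom (Calg clI) A :=
  Hom (is_hom_can centre_diag_is_hom centre_diagK centre_loK).

Lemma centre_diag_isomorphism : isomorphism centre_diag_hom.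
Proof.
by exists centre_lo_hom; split; apply: homE;
  [apply: centre_diagK | apply: centre_loK].
Qed.

End IntervalAlgebra.

Section IntervalQuasivariety.
Variables (S : bsignature) (rho : polarity S).
Variables (E : equation S xy -> Prop) (Q : algebra S -> Prop).
Hypothesis ordQ : poalgebras_ordered_by rho E Q.

Local Notation IQ := (IQ ordQ).
Local Notation Ialg := (Ialg ordQ).

Lemma IQ_implication (J : obj IQ) (V : countType) (I : finType)
    (prem : I -> equation (ext_sig S) V) (concl : equation (ext_sig S) V) :
  (forall A : obj Q, valid_implication (Ialg A) prem concl) ->
  valid_implication J prem concl.
Proof.
move=> Ivalid.
by apply: generated_quasivariety_implication (objP J) _ => _ [A ->].
Qed.

Lemma IQ_identity (J : obj IQ) (V : countType) (e : equation (ext_sig S) V) :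
  (forall (A : obj Q) (u : V -> Ialg A), holds u e) ->
  forall v : V -> J, holds v e.
Proof.
by move=> Ie; apply: generated_quasivariety_identity (objP J) _ => _ [A ->].
Qed.

Section Endpoints.
Variable J : obj IQ.

Lemma endpoint_endpoint (b c : bool) (x : J) :
  endpoint b (endpoint c x) = endpoint c x.
Proof.
pose X : term (ext_sig S) unit := Var tt.
have := @IQ_identity J unit
  (endpoint_term b (endpoint_term c X), endpoint_term c X) _ (fun=> x).
rewrite /holds !eval_endpoint; apply=> A u.
by rewrite !eval_endpoint interval_endpoint; case: b c => [] [].
Qed.

Lemma endpoint_ocst (b : bool) (c : csym S) :
  endpoint b (ocst J c) = ocst J c.
Proof.
pose t : term (ext_sig S) void := Cst (S := ext_sig S) (ECst c).
have := @IQ_identity J void (endpoint_term b t, t) _ (of_void J).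
rewrite /holds eval_endpoint; apply=> A u.
by rewrite eval_endpoint; case: b.
Qed.

Lemma endpoint_ociota (b : bool) :
  endpoint b (ociota J) = ocst J (if b then czero S else cone S).
Proof.
pose t : term (ext_sig S) void := Cst (S := ext_sig S) EIota.
pose s c : term (ext_sig S) void := Cst (S := ext_sig S) (ECst c).
have := @IQ_identity J void
  (endpoint_term b t, s (if b then czero S else cone S)) _ (of_void J).
rewrite /holds eval_endpoint; apply=> A u.
by rewrite eval_endpoint; case: b.
Qed.

Lemma endpoint_oop (b : bool) f (a : 'I_(ar f) -> J) :
  endpoint b (oop J f a) = oop J f (fun k => endpoint (b == rho k) (a k)).
Proof.
pose F ts := @App (ext_sig S) 'I_(ar f) (EFun f) ts.
pose t := endpoint_term b (F (@Var _ 'I_(ar f))).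
pose s := F (fun k => endpoint_term (b == rho k) (Var k)).
have evalE (K : algebra (ext_sig S)) (v : 'I_(ar f) -> K) :
    (eval v t = endpoint b (oop K f v)) *
    (eval v s = oop K f (fun k => endpoint (b == rho k) (v k))).
  split; first by rewrite eval_endpoint.
  by congr (oop K f _); apply: funext => k; apply: eval_endpoint.
rewrite -!evalE; apply: (IQ_identity (e := (t, s))) => A u.
by rewrite /holds !evalE interval_endpoint_oop.
Qed.

Lemma endpoint_inj (x y : J) :
  (forall b, endpoint b x = endpoint b y) -> x = y.
Proof.
move=> xy; pose prem b : equation (ext_sig S) bool :=
  (endpoint_term b (Var true), endpoint_term b (Var false)).
pose v b := if b then x else y.
have premE (K : algebra (ext_sig S)) (u : bool -> K) b :
    holds u (prem b) = (endpoint b (u true) = endpoint b (u false)).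
  by rewrite /holds !eval_endpoint.
apply: (@IQ_implication J _ _ prem (Var true, Var false) _ v) => [A u up|b].
  by apply: interval_endpoint_inj => b; rewrite -premE.
by rewrite premE.
Qed.

Lemma Cset_endpoint (b : bool) (x : J) : Cset (endpoint b x).
Proof. by apply/Cset_endpointP => c; apply: endpoint_endpoint. Qed.

Lemma Cset_sigma_closed : sigma_closed (@Cset S J).
Proof.
split=> [c|f a aC]; apply/Cset_endpointP => b; first exact: endpoint_ocst.
rewrite endpoint_oop; congr (oop J f _); apply: funext => k.
by have /Cset_endpointP := aC k.
Qed.

Lemma Delta_le_Nabla (x : J) : eq_le E (reduct J) (Delta x) (Nabla x).
Proof.
move=> e Ee; pose sigma w : term (ext_sig S) unit :=
  endpoint_term (if w is vx then true else false) (Var tt).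
have sigmaE (K : algebra (ext_sig S)) (u : unit -> K) :
    (fun w => eval u (sigma w)) = valxy (Delta (u tt)) (Nabla (u tt)).
  by apply: funext; case.
pose e_DeltaNabla := subst_equation sigma (lift_equation e).
have DeltaNablaE (K : algebra (ext_sig S)) (u : unit -> K) :
    holds u e_DeltaNabla =
    holds (A := reduct K) (valxy (Delta (u tt)) (Nabla (u tt))) e.
  by rewrite holds_subst holds_lift sigmaE.
rewrite -(DeltaNablaE J (fun=> x)); apply: IQ_identity => A u.
rewrite DeltaNablaE.
exact: (hom_eq_le (diag_hom (eq_le_poalgebra ordQ A)) (lo_le_hi (u tt)) Ee).
Qed.

End Endpoints.

Lemma quasivariety_Calg (J : obj IQ) :
  quasivariety Q -> Q (Calg (Cset_sigma_closed J)).
Proof.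
case=> T QT; apply/QT => q Tq.
apply/(satisfies_Delta_quasiequation _ _ (@Cset_endpoint J true)).
apply: IQ_implication => A.
pose IA := Ifunctor ordQ A.
apply/(satisfies_Delta_quasiequation (Cset_sigma_closed IA) _
  (@Cset_endpoint IA true)).
apply: (satisfies_injective (h := centre_lo_hom (Cset_sigma_closed IA))).
  exact: can_inj (centre_loK (clI := _)).
exact: ((QT A).1 (objP A) q Tq).
Qed.

Section Functors.
Hypothesis quasiQ : quasivariety Q.

Let I := Ifunctor ordQ.
Let C : functor_data IQ Q :=
  Cfunctor (fun J => quasivariety_Calg J quasiQ)
    (fun J K g => Cfun_is_hom g (Cset_sigma_closed J) (Cset_sigma_closed K)).

Lemma centre_is_functor : is_functor C.
Proof. by split=> *; apply: homE => x; apply: sval_inj. Qed.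

Definition centre_endpoint (J : obj IQ) (b : bool) (x : J) : C J :=
  exist _ _ (Cset_endpoint b x).

Lemma centre_faithful : faithful C.
Proof.
move=> J K g h gh; apply: homE => x; apply: endpoint_inj => b.
rewrite -!hom_endpoint.
pose value_at (k : hom (C J) (C K)) := sval (k (centre_endpoint b x)).
exact: (congr1 value_at gh).
Qed.

Definition iota_hom (A : obj Q) : hom A (C (I A)) :=
  centre_diag_hom (Cset_sigma_closed (I A)).

Lemma iota_natural :
  natural (F := id_functor Q) (G := comp_functor C I) iota_hom.
Proof.
by move=> A B h; apply: homE => a; apply: sval_inj; apply: intervalE.
Qed.

Lemma centre_Delta_le_Nabla (J : obj IQ) (x : J) :
  eq_le E (C J) (centre_endpoint true x) (centre_endpoint false x).
Proof.
apply: (eq_le_injective (h := centre_inclusion _)); first exact: sval_inj.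
exact: Delta_le_Nabla.
Qed.

Definition gamma_fun (J : obj IQ) (x : J) : I (C J) :=
  Interval (centre_Delta_le_Nabla x).

Lemma gamma_fun_eq (J : obj IQ) (x : J) (y : I (C J)) :
  (forall b, endpoint b x = sval (interval_bound b y)) -> gamma_fun x = y.
Proof.
move=> xy; apply: intervalE; apply: sval_inj.
- exact: (xy true).
- exact: (xy false).
Qed.

Lemma gamma_is_hom (J : obj IQ) : is_hom (@gamma_fun J).
Proof.
split=> [[c|]|[f||] a]; apply: gamma_fun_eq => b.
- by rewrite [LHS]endpoint_ocst; case: b.
- by rewrite [LHS]endpoint_ociota; case: b.
- rewrite [LHS]endpoint_oop.
  by case: b; congr (oop J f _); apply: funext => k;
    rewrite /lo_args /hi_args; case: (rho k).
all: have -> : a = (fun=> a ord0) by apply: funext => k; rewrite ord1.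
- by rewrite [LHS](endpoint_endpoint b true); case: b.
- by rewrite [LHS](endpoint_endpoint b false); case: b.
Qed.

Definition gamma_hom (J : obj IQ) : hom J (I (C J)) := Hom (@gamma_is_hom J).

Lemma gamma_injective (J : obj IQ) : injective (gamma_hom J).
Proof.
move=> x y xy; apply: endpoint_inj => -[].
- exact: (congr1 (fun z : I (C J) => sval (lo z)) xy).
- exact: (congr1 (fun z : I (C J) => sval (hi z)) xy).
Qed.

Lemma gamma_natural :
  natural (F := id_functor IQ) (G := comp_functor I C) gamma_hom.
Proof.
move=> J K g; apply: homE => x; apply: gamma_fun_eq => b.
by rewrite -hom_endpoint; case: b.
Qed.

End Functors.

End IntervalQuasivariety.

Theorem theorem8p7 (S : bsignature) (rho : polarity S)
    (E : equation S xy -> Prop) (Q : algebra S -> Prop)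
    (quasiQ : quasivariety Q) (ordQ : poalgebras_ordered_by rho E Q) :
  let I : functor_data Q (IQ ordQ) := Ifunctor ordQ in
  (* (i) *)
  exists Ccl : (forall J : obj (IQ ordQ), sigma_closed (@Cset S J)),
  (* (ii) *)
  exists (CQ : forall J : obj (IQ ordQ), Q (Calg (Ccl J)))
         (CC : forall (J K : obj (IQ ordQ)) (g : hom J K) (x : J),
                 Cset x -> Cset (g x))
         (Chom : forall (J K : obj (IQ ordQ)) (g : hom J K),
            @is_hom S (Calg (Ccl J)) (Calg (Ccl K)) (Cfun (CC J K g))),
  let C : functor_data (IQ ordQ) Q := Cfunctor CQ Chom in
  [/\ is_functor C,
      faithful C,
      (* (iii) *)
      exists iota : forall A : obj Q, hom A (C (I A)),
        [/\ forall (A : obj Q) (a : A),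
              sval (iota A a) = diag (eq_le_poalgebra ordQ A) a,
            forall A : obj Q, isomorphism (iota A)
          & natural (F := id_functor Q) (G := comp_functor C I) iota]
      (* (iv) *)
    & exists gamma : forall J : obj (IQ ordQ), hom J (I (C J)),
        [/\ forall (J : obj (IQ ordQ)) (a : J),
              sval (lo (gamma J a)) = Delta a /\
              sval (hi (gamma J a)) = Nabla a,
            forall J : obj (IQ ordQ), injective (gamma J)
          & natural (F := id_functor (IQ ordQ)) (G := comp_functor I C) gamma]].
Proof.
move=> I.
exists (Cset_sigma_closed (ordQ := ordQ)).
exists (fun J => quasivariety_Calg J quasiQ).
exists (fun J K g => @hom_Cset S J K g).
exists (fun J K g => Cfun_is_hom g (Cset_sigma_closed J) (Cset_sigma_closed K)).
split; [exact: centre_is_functor | exact: centre_faithful | |].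
- exists (iota_hom ordQ quasiQ); split=> // [A|]; last exact: iota_natural.
  exact: centre_diag_isomorphism.
- exists (gamma_hom quasiQ); split=> //; first exact: gamma_injective.
  exact: gamma_natural.
Qed.
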